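(* Let $G=(V,E)$ be a connected bipartite simple graph with $|V|=n$, with bipartite orientations $O_{\text{down}}$ and $O_{\text{up}}$, and let $O$ be any acyclic orientation of $E$. Then there exists an injective function from the set of linear extensions of $O$ to the set of linear extensions of $O_{\text{up}}$, and such an injection is surjective if and only if $O=O_{\text{up}}$ or $O=O_{\text{down}}$. Equivalently, $e(P_O)\le e(P_{O_{\text{up}}})$ with equality if and only if $O$ is one of the two bipartite orientations, where $P_O$ denotes the poset induced by $O$ and $e(\cdot)$ the number of linear extensions. Consequently, the acyclic orientations of $G$ maximizing the number of linear extensions are exactly the bipartite orientations.
   Context: If $G=(V,E)$ has bipartition $V=V_1\sqcup V_2$, its two bipartite orientations are the orientation choosing $(v_1,v_2)$ (meaning $v_1$ directed to $v_2$) for every edge $\{v_1,v_2\}$ with $v_1\in V_1$, $v_2\in V_2$, and the orientation choosing $(v_2,v_1)$ for every such edge. An acyclic orientation of $E$ induces a partial order on $V$ in which $u<v$ if and only if there is a directed path from $u$ to $v$. A linear extension of a partial order $P$ on an $n$-element set $V$ is a bijection $\sigma:V\to[n]$ such that $u<_P v$ implies $\sigma(u)<\sigma(v)$; $e(P)$ denotes the number of linear extensions of $P$, and a linear extension of an acyclic orientation means a linear extension of its induced poset. *)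

(* Defs.v *)
From HB Require Import structures.
From mathcomp Require Import all_boot.
Set Implicit Arguments. Unset Strict Implicit. Unset Printing Implicit Defensive.

Section Defs.
Variable T : finType.

Definition simple_graph (e : rel T) : Prop := symmetric e /\ irreflexive e.
Definition connected_graph (e : rel T) : Prop := forall u v : T, connect e u v.

Definition bipartition (e : rel T) (V1 : {set T}) : Prop :=
  forall u v, e u v -> (u \in V1) != (v \in V1).

(* An orientation of E is a set of arcs (u,v) (u directed to v) containing,
   for each edge {u,v}, exactly one of (u,v), (v,u), and nothing else. *)
Definition arc (O : {set T * T}) : rel T := fun u v => (u, v) \in O.

Definition orientation (e : rel T) (O : {set T * T}) : Prop :=
  (forall u v, arc O u v -> e u v) /\
  (forall u v, e u v -> arc O u v (+) arc O v u).

Definition acyclic (O : {set T * T}) : Prop :=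
  forall u v, arc O u v -> ~~ connect (arc O) v u.

Definition bip_orient (e : rel T) (V1 : {set T}) : {set T * T} :=
  [set p | e p.1 p.2 && (p.1 \in V1) && (p.2 \notin V1)].

Definition ind_lt (O : {set T * T}) : rel T :=
  fun u v => [exists w, arc O u w && connect (arc O) w v].

(* linear extensions: bijections sigma : V -> [n] (here 'I_n, 0-based)
   with u < v => sigma u < sigma v *)
Definition linext (O : {set T * T}) : {set {ffun T -> 'I_#|T|}} :=
  [set s : {ffun T -> 'I_#|T|} | injectiveb s &&
     [forall u, forall v, ind_lt O u v ==> (s u < s v)]].

End Defs.

(* Main.v *)
Require Import Defs.
From HB Require Import structures.
From mathcomp Require Import all_boot.
Set Implicit Arguments. Unset Strict Implicit. Unset Printing Implicit Defensive.

(** A linear extension of [O] is encoded by the sequence of the vertices in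
    increasing order.  Reading [a :: t] recursively, a first vertex outside [V1]
    is moved to the end of the image of [t]; a first vertex [a] in [V1] is put in
    front of the image of [t], and Schuetzenberger promotion is applied: [a]
    takes the place of its first neighbour [b], and [b] goes to the end.  Promotion is
    injective on the linear extensions of the bipartite orientation.  The two
    rules never give the same sequence, because this would make the adjacent
    vertices [a] and [b] both sources of [O].  If the resulting injection is onto,
    then the preimage of a linear extension that ends in [b], and in which [a] is the
    last neighbour of [b], starts with [a] or [b]; hence every edge has exactly one
    end that is a source of [O], and by connectedness the sources are one
    of the two sides. *)

(* [arc] would otherwise denote the sub-arc operation of [path]. *)
Local Notation arc := Defs.arc.

(** * Topological sequences, promotion, and the map [bipartize] *)

Section Sequences.

Variables (T : finType) (e : rel T).
Implicit Types (V : {set T}) (O : {set T * T}) (s t : seq T).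

Definition topological O s := pairwise (fun u v => ~~ arc O v u) s.

(** When [a] has no neighbour in [s] it ends up last; in [bipartize] this occurs once all neighbours
    of [a] have been read. *)
Fixpoint slide a s :=
  if s is b :: s' then
    if e a b then a :: rcons s' b else b :: slide a s'
  else [:: a].

Fixpoint bipartize V s :=
  if s is a :: t then
    if a \in V then slide a (bipartize V t) else rcons (bipartize V t) a
  else [::].

Lemma arc_bip_orient V u v :
  arc (bip_orient e V) u v = [&& e u v, u \in V & v \notin V].
Proof. by rewrite /Defs.arc inE /= andbA. Qed.

Lemma perm_slide a s : perm_eq (slide a s) (a :: s).
Proof.
elim: s => //= b s IHs; case: ifP => _; first by rewrite perm_cons perm_rcons.
apply: (@perm_trans _ (b :: a :: s)); first by rewrite perm_cons.
by rewrite -cat1s -[a :: s]cat1s perm_catCA.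
Qed.

Lemma perm_bipartize V s : perm_eq (bipartize V s) s.
Proof.
elim: s => //= a s IHs; case: ifP => _.
  by rewrite (perm_trans (perm_slide _ _)) // perm_cons.
by rewrite perm_rcons perm_cons.
Qed.

Lemma last_slide x a s : last x (slide a s) = a \/ e a (last x (slide a s)).
Proof.
elim: s x => [|b s IHs] x /=; first by left.
by case: ifP => ab /=; [rewrite last_rcons; right | apply: IHs].
Qed.

Lemma slide_first_neighbour a b s t :
  ~~ has (e a) s -> e a b -> slide a (s ++ b :: t) = s ++ a :: rcons t b.
Proof.
move=> + ab; elim: s => [|c s IHs] /=; first by rewrite ab.
by case/norP => /negPf -> /IHs ->.
Qed.

Lemma topological_bip_cat V s t :
  {subset s <= V} -> {subset t <= ~: V} -> topological (bip_orient e V) (s ++ t).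
Proof.
move=> sV tV; elim: s sV => [_|a s IHs sV] /=.
  elim: t tV => //= b t IHt tV; rewrite IHt ?andbT; last first.
    by move=> x xt; apply: tV; rewrite inE xt orbT.
  apply/allP => v vt; rewrite arc_bip_orient.
  have := tV v; rewrite !inE vt orbT => /(_ isT)/negPf ->.
  by rewrite /= andbF.
rewrite IHs ?andbT => [|x xs]; last by apply: sV; rewrite inE xs orbT.
by apply/allP => v _; rewrite arc_bip_orient (sV a) ?mem_head // !andbF.
Qed.

Lemma bipartition_edge V : bipartition e V ->
  forall u v, e u v -> (v \in V) = (u \notin V).
Proof. by move=> bip u v /bip; case: (u \in V); case: (v \in V). Qed.

Lemma bipartitionC V : bipartition e V -> bipartition e (~: V).
Proof. by move=> bip u v /bip; rewrite !inE; case: (u \in V); case: (v \in V). Qed.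

Lemma orientation_bip_orient V :
  symmetric e -> bipartition e V -> orientation e (bip_orient e V).
Proof.
move=> e_sym bip; split=> u v; rewrite !arc_bip_orient; first by case/andP.
by move=> uv; rewrite (e_sym v u) uv (bipartition_edge bip uv); case: (u \in V).
Qed.

(** * Injectivity of [bipartize] on a bipartite graph *)

Section Bipartite.

Variable V : {set T}.
Hypothesis bip : bipartition e V.
Let Oup := bip_orient e V.

(** Arcs of [Oup] leave [V]: [a] may precede anything and passes only non-neighbours, while the
    displaced neighbour lies outside [V] and so may come last. *)
Lemma topological_slide a s :
  a \in V -> topological Oup s -> topological Oup (slide a s).
Proof.
move=> aV; elim: s => //= b s IHs /andP[bs tops].
case: ifP => ab /=; last first.
  rewrite IHs // andbT (perm_all _ (perm_slide a s)) /= bs andbT.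
  by rewrite arc_bip_orient ab.
apply/andP; split.
  by apply/allP => v _; rewrite arc_bip_orient aV !andbF.
rewrite /topological pairwise_rcons (tops : pairwise _ s) andbT; apply/allP => v _.
by rewrite arc_bip_orient (bipartition_edge bip ab) aV !andbF.
Qed.

Lemma topological_bipartize s : topological Oup (bipartize V s).
Proof.
elim: s => //= a s IHs; case: ifP => aV; first exact: topological_slide.
rewrite /topological pairwise_rcons (IHs : pairwise _ _) andbT; apply/allP => v _.
by rewrite arc_bip_orient aV andbF.
Qed.

(* [slide] is undone by recovering [a] as the last neighbour of the final
   vertex; the hypotheses exclude later neighbours. *)
Lemma slide_inj a a' s s' :
  a \in V -> a' \in V -> topological Oup s -> topological Oup s' ->
  slide a s = slide a' s' -> a = a' /\ s = s'.
Proof.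
(* One slide stops at [b] while the other goes on: then [b] ends the second result, so it is
   adjacent to [y], which occurs after [b] in [b :: r], against [Oup]. *)
have mixed x y b r r' : x \in V -> y \in V -> e x b -> topological Oup (b :: r) ->
    rcons r b <> slide y r'.
  move=> xV yV xb /= /andP[br _] eq_r.
  have bV : b \notin V by rewrite (bipartition_edge bip xb) xV.
  have yNb : y != b by apply: contraNneq bV => <-.
  have yr : y \in r.
    have : y \in slide y r' by rewrite (perm_mem (perm_slide y r')) mem_head.
    by rewrite -eq_r mem_rcons inE (negPf yNb).
  have := last_slide b y r'; rewrite -eq_r last_rcons => -[by_eq|yb].
    by rewrite by_eq eqxx in yNb.
  by have /allP/(_ _ yr) := br; rewrite arc_bip_orient yb yV bV.
move=> aV a'V; elim: s s' => [|b s IHs] [|b' s'] tops tops' eq_s.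
- by case: eq_s.
- by have := perm_size (perm_slide a' (b' :: s')); rewrite -eq_s.
- by have := perm_size (perm_slide a (b :: s)); rewrite eq_s.
move: eq_s => /=; case: ifP => ab; case: ifP => a'b' [].
- by move=> -> /rcons_inj[-> ->].
- by move=> _ /(mixed _ _ _ _ _ aV a'V ab tops).
- by move=> _ /esym/(mixed _ _ _ _ _ a'V aV a'b' tops').
have [/andP[_ ts] /andP[_ ts']] := (tops, tops').
by move=> -> /(IHs _ ts ts')[-> ->].
Qed.

Lemma bipartize_inj O s s' : orientation e O ->
  topological O s -> topological O s' -> bipartize V s = bipartize V s' -> s = s'.
Proof.
move=> [_ ori].
(* The common last entry [a'] is a neighbour of [a] by [last_slide]; each of the two starts one of
   the sequences and occurs later in the other, so neither direction of their edge is possible. *)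
have mixed a t a' t' : a \in V -> a' \notin V -> topological O (a :: t) ->
    topological O (a' :: t') -> bipartize V (a :: t) <> bipartize V (a' :: t').
  move=> aV a'V /= /andP[at_ _] /andP[a't' _] eq_t.
  have aNa' : a != a' by apply: contraTneq aV => ->.
  have perm_t : perm_eq (a :: t) (a' :: t').
    rewrite -(permPl (perm_bipartize V (a :: t))) [bipartize _ _]eq_t.
    exact: perm_bipartize.
  move: eq_t; rewrite aV (negPf a'V) => eq_t.
  have := last_slide a a (bipartize V t); rewrite eq_t last_rcons.
  case=> [eq_a|/ori]; first by rewrite eq_a eqxx in aNa'.
  have a't : a' \in t.
    by have := perm_mem perm_t a'; rewrite !inE eqxx eq_sym (negPf aNa').
  have at' : a \in t'.
    by have := perm_mem perm_t a; rewrite !inE eqxx (negPf aNa').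
  by rewrite (negPf (allP at_ _ a't)) (negPf (allP a't' _ at')).
elim: s s' => [|a t IHs] [|a' t'] tops tops' eq_s //.
- by have := perm_size (perm_bipartize V (a' :: t')); rewrite -eq_s.
- by have := perm_size (perm_bipartize V (a :: t)); rewrite eq_s.
have [/andP[_ ts] /andP[_ ts']] := (tops, tops').
case aV: (a \in V); case a'V: (a' \in V).
- move: eq_s; rewrite /= aV a'V.
  case/(slide_inj aV a'V (topological_bipartize _) (topological_bipartize _)).
  by move=> -> /(IHs _ ts ts') ->.
- by case: (mixed a t a' t'); rewrite ?aV ?a'V.
- by case: (mixed a' t' a t); rewrite ?aV ?a'V.
- by move: eq_s; rewrite /= aV a'V => /rcons_inj[/(IHs _ ts ts') -> ->].
Qed.

(** For an edge from [a] in [V] to [b], sliding [a] into this sequence gives the rest of [V], then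
    [a], then the complement of [V] with [b] last: the linear extension that tests this edge. *)
Lemma topological_bip_witness a b : b \notin V ->
  topological Oup (enum (V :\ a) ++ b :: enum (~: V :\ b)).
Proof.
move=> bV; apply: topological_bip_cat => y.
  by rewrite mem_enum inE => /andP[].
by rewrite !inE mem_enum !inE => /orP[/eqP->|/andP[]].
Qed.

(** A head in [V] was inserted by [slide], so [slide_inj] identifies it with [a]; any other head was
    moved to the end, where [b] stands. *)
Lemma head_preimage_bipartize a b s :
  e a b -> a \in V ->
  bipartize V s = slide a (enum (V :\ a) ++ b :: enum (~: V :\ b)) ->
  head a s \in [:: a; b].
Proof.
move=> ab aV; case: s => [|x s] /=; first by rewrite mem_head.
set w := _ ++ _ => eq_w.
have bV : b \notin V by rewrite (bipartition_edge bip ab) aV.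
case: ifP eq_w => xV eq_w.
  have topw : topological Oup w by apply: topological_bip_witness.
  have [-> _] := slide_inj xV aV (topological_bipartize s) topw eq_w.
  exact: mem_head.
have := congr1 (last a) eq_w; rewrite last_rcons slide_first_neighbour //.
  by rewrite last_cat /= last_rcons => ->; rewrite !inE eqxx orbT.
apply/hasPn => y; rewrite mem_enum inE => /andP[_ yV]; apply/negP => ay.
by rewrite (bipartition_edge bip ay) aV in yV.
Qed.

Lemma perm_bip_witness a b :
  a \in V -> b \notin V ->
  perm_eq (slide a (enum (V :\ a) ++ b :: enum (~: V :\ b))) (enum T).
Proof.
move=> aV bV; rewrite (perm_trans (perm_slide _ _)) //; apply: uniq_perm.
- rewrite /= mem_cat inE !mem_enum !inE eqxx aV /= andbF orbF.
  rewrite (contraTneq _ aV) => [|->] //=.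
  rewrite cat_uniq enum_uniq /= !mem_enum !inE eqxx (negPf bV) andbF enum_uniq.
  rewrite /= andbT; apply/hasPn => y; rewrite !mem_enum !inE.
  by case/andP => _ /negPf ->; rewrite andbF.
- exact: enum_uniq.
move=> y; rewrite !inE mem_cat inE !mem_enum !inE.
by do 2!case: eqP => //= _; case: (y \in V).
Qed.

End Bipartite.

End Sequences.

(** * Linear extensions as tuples of vertices *)

Section Counting.

Variable T : finType.
Implicit Types (e : rel T) (V : {set T}) (O : {set T * T}).

Definition linear_orders O : {set #|T|.-tuple T} :=
  [set t : #|T|.-tuple T | uniq t && topological O t].

Lemma mem_full_tuple (t : #|T|.-tuple T) x : uniq t -> x \in tval t.
Proof.
move=> ut; have sub : {subset t <= enum T} by move=> y _; rewrite mem_enum.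
have le : size (enum T) <= size t by rewrite size_tuple cardE.
by have [_ ->] := uniq_min_size ut sub le; rewrite mem_enum.
Qed.

(** Irreflexivity excludes loops, which [pairwise] does not test. *)
Lemma topologicalP O t : uniq t -> (forall u, ~~ arc O u u) ->
  reflect {in t &, forall u v, arc O u v -> index u t < index v t}
    (topological O t).
Proof.
move=> ut irr; case: t ut => [|x0 t0]; first by left.
set t := x0 :: t0 => ut; apply: (iffP (pairwiseP x0)) => top.
  move=> u v u_t v_t uv; rewrite ltnNge leq_eqVlt; apply/negP => /orP[|lt_vu].
    move/eqP/(congr1 (nth x0 t)); rewrite !nth_index // => vu.
    by rewrite vu (negPf (irr u)) in uv.
  have := top (index v t) (index u t); rewrite !inE !index_mem u_t v_t lt_vu.
  by rewrite !nth_index // uv => /(_ isT isT isT).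
move=> i j; rewrite !inE => lt_i lt_j lt_ij; apply/negP => /top.
rewrite !mem_nth // !index_uniq // => /(_ isT isT).
by rewrite ltnNge ltnW.
Qed.

(** The default [enum_rank x] is never taken when [t] is duplicate-free. *)
Definition rank_of (t : #|T|.-tuple T) : {ffun T -> 'I_#|T|} :=
  [ffun x => insubd (enum_rank x) (index x t)].

Lemma val_rank_of (t : #|T|.-tuple T) x : uniq t -> rank_of t x = index x t :> nat.
Proof.
move=> ut; rewrite ffunE val_insubd.
by rewrite -[X in _ < X](size_tuple t) index_mem mem_full_tuple.
Qed.

(** Monotonicity along arcs propagates along directed paths, so arcs can stand in for the induced
    order. *)
Lemma linextP O (s : {ffun T -> 'I_#|T|}) :
  reflect (injective s /\ forall u v, arc O u v -> s u < s v) (s \in linext O).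
Proof.
rewrite inE; apply: (iffP andP) => -[].
  move/injectiveP => inj_s /'forall_'forall_implyP mono; split=> // u v uv.
  by apply: mono; apply/existsP; exists v; rewrite uv connect0.
move=> inj_s mono; split; first exact/injectiveP.
apply/'forall_'forall_implyP => u v /existsP[w /andP[/mono lt_uw]].
case/connectP => p; elim: p w lt_uw => [|y p IHp] w lt_uw /=.
  by move=> _ ->.
by case/andP => /mono /(ltn_trans lt_uw) lt_uy /(IHp _ lt_uy).
Qed.

Lemma card_linext O : (forall u, ~~ arc O u u) -> #|linext O| = #|linear_orders O|.
Proof.
move=> irr; have -> : linext O = rank_of @: linear_orders O.
  apply/setP => s; apply/linextP/imsetP => [[inj_s mono]|[t + ->]]; last first.
    rewrite inE => /andP[ut /(topologicalP ut irr) top]; split.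
      move=> x y /(congr1 val) /=; rewrite !val_rank_of // => eq_i.
      rewrite -(nth_index x (mem_full_tuple x ut)) eq_i.
      by rewrite nth_index ?mem_full_tuple.
    by move=> u v uv; rewrite !val_rank_of // top ?mem_full_tuple.
  (* The inverse of [s] lists the vertices in increasing order. *)
  have [g sK gK] : bijective s by apply: inj_card_bij => //; rewrite card_ord.
  pose t := [tuple g i | i < #|T|].
  have idx x : index x t = s x.
    by rewrite /= -{1}(sK x) index_map ?index_enum_ord //; apply: can_inj gK.
  have ut : uniq t by rewrite map_inj_uniq ?enum_uniq //; apply: can_inj gK.
  exists t; last first.
    by apply/ffunP => x; apply: ord_inj; rewrite -idx val_rank_of.
  rewrite inE ut; apply/(topologicalP ut irr) => u v _ _ /mono.
  by rewrite !idx.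
apply: card_in_imset => t t'; rewrite !inE => /andP[ut _] /andP[ut' _] eq_t.
apply: eq_from_tnth => i; set x := tnth t i.
have : index x t = index x t'.
  by rewrite -(val_rank_of x ut) -(val_rank_of x ut') eq_t.
rewrite {1}/x (tnth_nth x) index_uniq ?size_tuple // => eq_i.
by rewrite (tnth_nth x t') eq_i nth_index ?mem_full_tuple.
Qed.

Lemma bipartize_tupleP e V (t : #|T|.-tuple T) : size (bipartize e V t) == #|T|.
Proof. by rewrite (perm_size (perm_bipartize e V t)) size_tuple. Qed.

Definition bipartize_tuple e V t := Tuple (bipartize_tupleP e V t).

(** * The inequality and its equality case *)

Section Comparison.

Variables (e : rel T) (V : {set T}) (O : {set T * T}).
Hypotheses (simple : simple_graph e) (bip : bipartition e V).
Hypothesis (ori : orientation e O).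
Let Oup := bip_orient e V.

Lemma orientation_irr O' : orientation e O' -> forall u, ~~ arc O' u u.
Proof. by move=> [sub _] u; apply/negP => /sub; rewrite (proj2 simple). Qed.

Lemma card_bipartize_tuple :
  #|bipartize_tuple e V @: linear_orders O| = #|linext O|.
Proof.
rewrite card_linext; last exact: orientation_irr.
apply: card_in_imset => t t'; rewrite !inE => /andP[_ top] /andP[_ top'].
move=> /(congr1 val) /= eq_t; apply: val_inj.
exact: (bipartize_inj bip ori top top' eq_t).
Qed.

Lemma bipartize_tuple_sub :
  bipartize_tuple e V @: linear_orders O \subset linear_orders Oup.
Proof.
apply/subsetP => _ /imsetP[t + ->]; rewrite !inE => /andP[ut _] /=.
rewrite (perm_uniq (perm_bipartize e V t)) ut.
exact: (topological_bipartize bip).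
Qed.

Let ori_up : orientation e Oup := orientation_bip_orient (proj1 simple) bip.

Lemma leq_card_linext : #|linext O| <= #|linext Oup|.
Proof.
rewrite -card_bipartize_tuple (card_linext (orientation_irr ori_up)).
exact: subset_leq_card bipartize_tuple_sub.
Qed.

Definition source u := [forall v, ~~ arc O v u].

Lemma source_head a t :
  topological O (a :: t) -> (forall x, x \in a :: t) -> source a.
Proof.
move=> /= /andP[/allP at_ _] full; apply/forallP => v.
have := full v; rewrite inE => /predU1P[->|/at_ //].
exact: orientation_irr.
Qed.

Lemma edge_has_source u v :
  #|linext O| = #|linext Oup| -> e u v -> source u (+) source v.
Proof.
move=> eq_card.
have excl x y : e x y -> ~~ (source x && source y).
  move=> /(proj2 ori) xy; apply/negP => /andP[/forallP sx /forallP sy].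
  by move: xy; rewrite (negPf (sx y)) (negPf (sy x)).
(* Equal cardinalities make the injection onto, so the witness for the edge has a preimage, whose
   head is a source. *)
have onto : bipartize_tuple e V @: linear_orders O = linear_orders Oup.
  apply/eqP; rewrite eqEcard bipartize_tuple_sub card_bipartize_tuple eq_card.
  by rewrite (card_linext (orientation_irr ori_up)) /=.
wlog uV : u v / u \in V => [wlog_uV uv|uv].
  case uV: (u \in V); first exact: wlog_uV.
  rewrite addbC wlog_uV // 1?(proj1 simple) //.
  by rewrite (bipartition_edge bip uv) uV.
have vV : v \notin V by rewrite (bipartition_edge bip uv) uV.
pose w := slide e u (enum (V :\ u) ++ v :: enum (~: V :\ v)).
have perm_w : perm_eq w (enum T) by apply: perm_bip_witness.
have size_w : size w == #|T| by rewrite (perm_size perm_w) cardE.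
have : Tuple size_w \in linear_orders Oup.
  rewrite inE /= (perm_uniq perm_w) enum_uniq /=.
  exact/(topological_slide bip uV)/topological_bip_witness.
rewrite -onto => /imsetP[t + /(congr1 val)/= /esym].
rewrite inE => /andP[ut top].
move/(head_preimage_bipartize bip uv uV).
have : source (head u t).
  have full x := mem_full_tuple x ut.
  case: (tval t) top full => [|a t'] top full; first by have := full u.
  exact: source_head top full.
have := excl _ _ uv.
by rewrite !inE => + + /orP[]/eqP eq_h;
  rewrite eq_h => + s; rewrite s ?andbT /= => /negPf ->.
Qed.

(** The end of an arc is never a source, so its start is the one source on that edge: the set of
    sources determines [O]. *)
Lemma bip_orient_of_sources (W : {set T}) :
  (forall u v, e u v -> source u (+) source v) -> source =1 mem W ->
  O = bip_orient e W.
Proof.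
move=> src srcW; apply/setP => -[u v]; rewrite -[LHS]/(arc O u v).
rewrite -[RHS]/(arc (bip_orient e W) u v) arc_bip_orient.
have -> : (u \in W) = source u by rewrite srcW.
have -> : (v \in W) = source v by rewrite srcW.
apply/idP/and3P => [uv|[uv /forallP su _]]; last first.
  by have := proj2 ori _ _ uv; rewrite (negPf (su v)) addbF.
have e_uv := proj1 ori _ _ uv; have := src _ _ e_uv.
have -> : source v = false by apply/negP => /forallP/(_ u); rewrite uv.
by rewrite addbF => ->.
Qed.

Lemma eq_card_linext_bip : connected_graph e ->
  #|linext O| = #|linext Oup| -> O = Oup \/ O = bip_orient e (~: V).
Proof.
move=> conn eq_card.
have src u v := @edge_has_source u v eq_card.
case: (pickP (@predT T)) => [x0 _|T0]; last first.
  by left; apply/setP => -[u v]; have := T0 u.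
(* Being a source and lying in [V] both switch along every edge, so their exclusive or is constant
   on a connected graph; its value selects the side. *)
have const x : source x (+) (x \in V) = source x0 (+) (x0 \in V).
  case/connectP: (conn x x0) => p; elim: p x => [|y p IHp] x /=.
    by move=> _ ->.
  case/andP => xy /IHp {}IHp /IHp <-.
  rewrite (bipartition_edge bip xy); have := src _ _ xy.
  by do 2!case: (source _); case: (x \in V).
case c: (source x0 (+) (x0 \in V)) const => const; [right | left];
  apply: bip_orient_of_sources => // x; have := const x; rewrite /= ?inE;
  by case: (source x); case: (x \in V).
Qed.

End Comparison.

End Counting.

(** The enumerations of [A] and [B] are matched by position; on [A] the default [x] is never
    reached. *)
Lemma leq_card_inj (S : finType) (A B : {set S}) : #|A| <= #|B| ->
  exists f : S -> S, {in A, forall x, f x \in B} /\ {in A &, injective f}.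
Proof.
move=> leAB; exists (fun x => nth x (enum B) (index x (enum A))).
have lt_i x : x \in A -> index x (enum A) < size (enum B).
  by move=> xA; rewrite -cardE (leq_trans _ leAB) // cardE index_mem mem_enum.
split=> [x xA|x y xA yA]; first by rewrite -mem_enum mem_nth ?lt_i.
rewrite (set_nth_default x y) ?lt_i // => /eqP.
rewrite nth_uniq ?lt_i ?enum_uniq // => /eqP/(congr1 (nth x (enum A))).
by rewrite !nth_index ?mem_enum.
Qed.

Theorem theorem2p6 (T : finType) (e : rel T) (V1 : {set T})
    (O : {set T * T}) :
  simple_graph e -> connected_graph e -> bipartition e V1 ->
  orientation e O -> acyclic O ->
  let Oup := bip_orient e V1 in
  let Odown := bip_orient e (~: V1) in
  (* existence of an injection from linext O into linext Oup *)
  (exists f : {ffun T -> 'I_#|T|} -> {ffun T -> 'I_#|T|},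
      {in linext O, forall s, f s \in linext Oup} /\ {in linext O &, injective f})
  /\
  (* every such injection is surjective iff O is a bipartite orientation *)
  (forall f : {ffun T -> 'I_#|T|} -> {ffun T -> 'I_#|T|},
      {in linext O, forall s, f s \in linext Oup} ->
      {in linext O &, injective f} ->
      (linext Oup \subset f @: linext O <-> O = Oup \/ O = Odown))
  /\
  (* counting form *)
  #|linext O| <= #|linext Oup|
  /\ (#|linext O| = #|linext Oup| <-> O = Oup \/ O = Odown).
Proof.
move=> simple conn bip ori _ Oup Odown.
have le_card : #|linext O| <= #|linext Oup| by apply: leq_card_linext.
have eq_card : #|linext O| = #|linext Oup| <-> O = Oup \/ O = Odown.
  split; first exact: eq_card_linext_bip.
  (* [Odown] is the upward orientation of the bipartition with its sides exchanged, so the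
     inequality also holds in reverse. *)
  case=> [->//|O_down]; apply/eqP; rewrite eqn_leq le_card O_down.
  apply: leq_card_linext => //; first exact: bipartitionC.
  by apply: orientation_bip_orient => //; case: simple.
split; first exact: leq_card_inj.
split=> // f f_up f_inj; apply: iff_trans eq_card.
(* For an injective [f], surjectivity amounts to equality of the two cardinals. *)
have card_f : #|f @: linext O| = #|linext O| by apply: card_in_imset.
have sub : f @: linext O \subset linext Oup.
  by apply/subsetP => _ /imsetP[s sO ->]; apply: f_up.
split=> [sup|eq_c].
  by apply/eqP; rewrite eqn_leq le_card -card_f subset_leq_card.
have /eqP -> // : f @: linext O == linext Oup.
by rewrite eqEcard sub card_f eq_c leqnn.
Qed.
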